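(* Let $r\ge s$ be positive integers, and let $\zeta=\zeta_1\circ\zeta_2\circ\cdots\circ\zeta_{s-1}\colon \mathbb R_+^{T_{r,s}}\to\mathbb R_+^{R_{r,s}}$ be the birational map between labelings of the trapezoid and the rectangle defined in the context. Let $\mathscr C$ and $\mathscr C'$ be the sets of all maximal chains in $T_{r,s}$ and $R_{r,s}$, respectively. Then for all $x\in\mathbb R_+^{T_{r,s}}$, $w_{\mathscr C}(x)=w_{\mathscr C'}(\zeta(x))$.
   Context: All posets are finite, $\mathbb R_+$ denotes the positive reals, $\lessdot$ denotes cover relations, and $[n]=\{1,\dots,n\}$. For a poset $P$, $x\in\mathbb R_+^P$ and a collection $\mathscr C$ of chains of $P$, $w_{\mathscr C}(x)=\sum_{C\in\mathscr C}\prod_{p\in C}x_p$. Posets (all with the componentwise order): $R_{r,s}=[r]\times[s]$; the right trapezoid $RT_{r,s}=\{(i,j)\in[r+s-1]\times[s] : i-j<r\}$; the trapezoid $T_{r,s}=\{(i,j)\in RT_{r,s}: i+j>s\}$. For $1\le k\le s$ the intermediate poset $I_k$ is the induced subposet of $RT_{r,s}$ on $T_{r,k}\cup[(k,k+1),(r+k-1,s)]$ (the second set is an interval of $RT_{r,s}$, empty when $k=s$). One has $I_1=R_{r,s}$ and $I_s=T_{r,s}$. Antichain rowmotion: for a poset $P$ and $p\in P$, the toggle $\tau_p\colon\mathbb R_+^P\to\mathbb R_+^P$ replaces $x_p$ by $\left(\sum_{C}\prod_{q\in C}x_q\right)^{-1}$, where $C$ ranges over all maximal chains of $P$ containing $p$,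 and fixes all other coordinates. Then $\tilde\rho=\tau_{L^{-1}(n)}\circ\cdots\circ\tau_{L^{-1}(1)}$ for any linear extension $L\colon P\to[n]$; it is a bijection independent of $L$. The maps $\zeta_k\colon\mathbb R_+^{I_{k+1}}\to\mathbb R_+^{I_k}$ ($1\le k\le s-1$): let $M_k$ be the interval $[(k,1),(r+k,k+1)]$ of $RT_{r,s}$ and let $\tilde\rho_k$ be antichain rowmotion on $M_k$. For $x\in\mathbb R_+^{I_{k+1}}$ let $\bar x\in\mathbb R_+^{M_k}$ be obtained by restricting $x$ to $M_k\setminus\{(k,1)\}\subseteq I_{k+1}$ and setting $\bar x_{k,1}=1$ (any positive value gives the same map). Then $$\zeta_k(x)_{ij}=\begin{cases}\tilde\rho_k^{-1}(\bar x)_{ij}&\text{if }(i,j)\in I_k\cap M_k=M_k\setminus\{(r+k,k+1)\},\\ x_{i+1,j}&\text{if }(i,j)\in I_k\setminus M_k\text{ and }j>k+1,\\ x_{i,j+1}&\text{if }(i,j)\in I_k\setminus M_k\text{ and }i<k.\end{cases}$$ *)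

(* Defs.v *)
From mathcomp Require Import all_boot all_order all_algebra zify.
From mathcomp Require Import boolp classical_sets functions reals.

Set Implicit Arguments.
Unset Strict Implicit.
Unset Printing Implicit Defensive.

Import Order.TTheory GRing.Theory Num.Theory.
Local Open Scope ring_scope.

(* A finite poset is given as an induced subposet [P : {set T}] of an ambient
   [T : finPOrderType d]. A labeling of [P] is an [x : {ffun T -> R}] of which
   only the values on [P] matter; [pos_labelings P] plays the role of R_+^P. *)

Definition chain d (T : finPOrderType d) (C : {set T}) : bool :=
  [forall p in C, forall q in C, (p >=< q)%O].

Definition max_chains d (T : finPOrderType d) (P : {set T}) : {set {set T}} :=
  [set C | maxset (fun D : {set T} => (D \subset P) && chain D) C].

Definition weight d (T : finPOrderType d) (R : realType)
    (CC : {set {set T}}) (x : {ffun T -> R}) : R :=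
  \sum_(C in CC) \prod_(p in C) x p.

Definition pos_labelings d (T : finPOrderType d) (R : realType)
    (P : {set T}) : set {ffun T -> R} :=
  [set x | forall p, p \in P -> 0 < x p]%classic.

Definition toggle d (T : finPOrderType d) (R : realType)
    (P : {set T}) (p : T) (x : {ffun T -> R}) : {ffun T -> R} :=
  [ffun q => if q == p then (weight [set C in max_chains P | p \in C] x)^-1
             else x q].

(* The sequence [L] lists L^-1(1), ..., L^-1(n). *)
Definition linear_extension d (T : finPOrderType d)
    (P : {set T}) (L : seq T) : Prop :=
  [/\ uniq L, L =i P &
      forall p q, p \in P -> q \in P -> (p < q)%O -> (index p L < index q L)%N].

(* The toggle at the head of [L] is applied first. *)
Definition rowmotion_along d (T : finPOrderType d) (R : realType)
    (P : {set T}) (L : seq T) (x : {ffun T -> R}) : {ffun T -> R} :=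
  foldl (fun y p => toggle P p y) x L.

(* A particular linear extension (see [std_extP]): sort by the size of
   principal ideals. By [rowmotionE] the choice does not matter. *)
Definition height d (T : finPOrderType d) (P : {set T}) (p : T) : nat :=
  #|[set q in P | (q <= p)%O]|.

Definition std_ext d (T : finPOrderType d) (P : {set T}) : seq T :=
  sort (relpre (height P) leq) (enum P).

Definition rowmotion d (T : finPOrderType d) (R : realType)
    (P : {set T}) : {ffun T -> R} -> {ffun T -> R} :=
  rowmotion_along P (std_ext P).

(* By [rowmotion_bij] this is a two-sided inverse on [pos_labelings P]. *)
Definition rowmotion_inv d (T : finPOrderType d) (R : realType)
    (P : {set T}) : {ffun T -> R} -> {ffun T -> R} :=
  'pinv_id (pos_labelings P) (rowmotion P).

Lemma std_extP d (T : finPOrderType d) (P : {set T}) :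
  linear_extension P (std_ext P).
Proof.
have Pm : std_ext P =i P by move=> p; rewrite mem_sort mem_enum.
split=> //; first by rewrite sort_uniq enum_uniq.
move=> p q pP qP pq; rewrite ltnNge; apply/negP => le_qp.
have tot : total (relpre (height P) leq) by move=> a b; apply: leq_total.
have tr : transitive (relpre (height P) leq) by move=> a b c; apply: leq_trans.
have rf : reflexive (relpre (height P) leq) by move=> a /=.
have := sorted_leq_index tr rf (sort_sorted tot (enum P)).
move=> /(_ q p); rewrite !Pm => /(_ qP pP le_qp) /=.
rewrite leqNgt => /negP; apply; apply: proper_card; apply/fintype.properP; split.
  by apply/fintype.subsetP => a; rewrite !inE => /andP[-> /le_trans]; apply; exact: ltW.
by exists q; rewrite !inE ?qP ?lexx // (lt_geF pq).
Qed.

Lemma max_chain_cmp d (T : finPOrderType d) (P C : {set T}) (p q : T) :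
  C \in max_chains P -> p \in C -> q \in C -> (p >=< q)%O.
Proof.
rewrite inE => /maxsetP[/andP[_ /forall_inP chC] _] pC qC.
by have /forall_inP := chC p pC; apply.
Qed.

Lemma toggleC d (T : finPOrderType d) (R : realType) (P : {set T}) (p q : T)
    (x : {ffun T -> R}) : ~~ (p >=< q)%O ->
  toggle P p (toggle P q x) = toggle P q (toggle P p x).
Proof.
have aux (a b : T) (y : {ffun T -> R}) : ~~ (a >=< b)%O ->
    weight [set C in max_chains P | a \in C] (toggle P b y)
    = weight [set C in max_chains P | a \in C] y.
  move=> ab; apply: eq_bigr => C; rewrite inE => /andP[CM aC].
  apply: eq_bigr => c cC; rewrite ffunE; case: eqP => // cb.
  by case/negP: ab; apply: max_chain_cmp CM aC _; rewrite -cb.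
move=> pq; have qp : ~~ (q >=< p)%O by rewrite comparable_sym.
apply/ffunP => c.
rewrite {1}/toggle ffunE aux // [in RHS]/toggle ffunE aux // !ffunE.
have neq : p != q by apply: contraNneq pq => ->; exact: comparablexx.
case: (eqVneq c p) => [->|//]; by rewrite (negPf neq).
Qed.

Lemma linear_extension_pairwise d (T : finPOrderType d) (P : {set T})
    (L : seq T) :
  linear_extension P L -> pairwise (fun p q : T => ~~ (q < p)%O) L.
Proof.
case=> uL LP Lo; case E: L => [//|a L0]; rewrite -E.
apply/(pairwiseP a) => i j; rewrite !inE => iL jL ij.
apply/negP => lt_ji; have := Lo _ _ _ _ lt_ji.
rewrite -!LP !mem_nth // !index_uniq // => /(_ isT isT).
by rewrite ltnNge (ltnW ij).
Qed.

Lemma toggle_cat d (T : finPOrderType d) (R : realType) (P : {set T}) (p : T)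
    (A : seq T) (x : {ffun T -> R}) :
  all (fun a => ~~ (p >=< a)%O) A ->
  toggle P p (rowmotion_along P A x) = rowmotion_along P A (toggle P p x).
Proof.
elim: A x => [//|a A IH] x /= /andP[pa pA].
by rewrite /rowmotion_along /= -/(rowmotion_along P A _) IH // toggleC.
Qed.

(* Independence of the linear extension. *)
Lemma rowmotionE d (T : finPOrderType d) (R : realType) (P : {set T})
    (L : seq T) (x : {ffun T -> R}) :
  linear_extension P L -> rowmotion P x = rowmotion_along P L x.
Proof.
have key (L1 L2 : seq T) (y : {ffun T -> R}) :
    uniq L1 -> perm_eq L1 L2 ->
    pairwise (fun p q : T => ~~ (q < p)%O) L1 ->
    pairwise (fun p q : T => ~~ (q < p)%O) L2 ->
    rowmotion_along P L1 y = rowmotion_along P L2 y.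
  elim: L1 L2 y => [|p L1 IH] L2 y; first by move=> _; rewrite perm_sym => /perm_nilP ->.
  move=> uL pL /= /andP[pall pw1] pw2.
  have pL2 : p \in L2 by rewrite -(perm_mem pL) mem_head.
  case/splitPr: pL2 pL pw2 => A B pL pw2.
  have pAB : perm_eq L1 (A ++ B).
    by move: pL; rewrite perm_sym perm_catC /= perm_cons perm_catC perm_sym.
  move: pw2; rewrite pairwise_cat /= => /and3P[rAB pwA /andP[_ pwB]].
  move: (uL) => /= /andP[pL1 uL1].
  rewrite /rowmotion_along foldl_cat /= -!/(rowmotion_along _ _ _).
  rewrite toggle_cat.
    rewrite (IH (A ++ B)) // /rowmotion_along ?foldl_cat //.
    rewrite pairwise_cat pwA pwB !andbT; apply/allrelP => a b aA bB.
    by move/allrelP: rAB; apply => //; rewrite inE bB orbT.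
  apply/allP => a aA; have aL1 : a \in L1 by rewrite (perm_mem pAB) mem_cat aA.
  have nap : ~~ (a < p)%O by move/allP: pall; apply.
  have npa : ~~ (p < a)%O.
    by move/allrelP: rAB; apply => //; rewrite mem_head.
  have ne : p != a by apply: contraNneq pL1 => ->.
  by case: (comparableP p a) nap npa ne.
move=> extL; have extS := std_extP P.
have [uS SP _] := extS; have [uL LP _] := extL.
apply: key => //.
- by apply: uniq_perm => // p; rewrite SP LP.
- exact: linear_extension_pairwise extS.
- exact: linear_extension_pairwise extL.
Qed.

Lemma weight_gt0 d (T : finPOrderType d) (R : realType) (P : {set T}) (p : T)
    (x : {ffun T -> R}) : pos_labelings P x -> p \in P ->
  0 < weight [set C in max_chains P | p \in C] x.
Proof.
move=> xP pP; pose Q := fun D : {set T} => (D \subset P) && chain D.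
have Q1 : Q [set p].
  rewrite /Q finset.sub1set pP; apply/forall_inP => a /set1P ->.
  by apply/forall_inP => b /set1P ->; exact: comparablexx.
have [C CM pC] := maxset_exists Q1; rewrite finset.sub1set in pC.
have CP : C \in [set C in max_chains P | p \in C] by rewrite !inE CM.
have prod_gt0 D : D \in [set C in max_chains P | p \in C] ->
    0 < \prod_(q in D) x q.
  rewrite !inE => /andP[/maxsetP[/andP[DP _] _] _].
  by apply: prodr_gt0 => q qD; apply: xP; apply: (fintype.subsetP DP).
rewrite /weight (bigD1 C) //=; apply: ltr_wpDr; last exact: prod_gt0.
by apply: sumr_ge0 => D /andP[/prod_gt0/ltW].
Qed.

Lemma toggle_pos d (T : finPOrderType d) (R : realType) (P : {set T}) (p : T)
    (x : {ffun T -> R}) : p \in P -> pos_labelings P x ->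
  pos_labelings P (toggle P p x).
Proof.
move=> pP xP q qP; rewrite ffunE; case: ifP => _; last exact: xP.
by rewrite invr_gt0 weight_gt0.
Qed.

Lemma toggleK d (T : finPOrderType d) (R : realType) (P : {set T}) (p : T)
    (x : {ffun T -> R}) : p \in P -> pos_labelings P x ->
  toggle P p (toggle P p x) = x.
Proof.
move=> pP xP; pose S (y : {ffun T -> R}) :=
  \sum_(C in [set C in max_chains P | p \in C]) \prod_(q in C | q != p) y q.
have wE (y : {ffun T -> R}) :
    weight [set C in max_chains P | p \in C] y = y p * S y.
  rewrite mulr_sumr; apply: eq_bigr => C; rewrite inE => /andP[_ pC].
  by rewrite (bigD1 p).
have St : S (toggle P p x) = S x.
  apply: eq_bigr => C _; apply: eq_bigr => q /andP[_ qp].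
  by rewrite ffunE (negPf qp).
have := weight_gt0 xP pP; rewrite wE => xS_gt0.
have x0 : x p != 0 by rewrite gt_eqF // xP.
have S0 : S x != 0 by apply: contraTneq xS_gt0 => ->; rewrite mulr0 ltxx.
apply/ffunP => q; rewrite {1}/toggle ffunE; case: eqP => [->|/eqP qp].
  by rewrite wE St ffunE eqxx wE invfM invrK mulfK.
by rewrite ffunE (negPf qp).
Qed.

Lemma rowmotion_along_pos d (T : finPOrderType d) (R : realType)
    (P : {set T}) (L : seq T) (x : {ffun T -> R}) :
  {subset L <= P} -> pos_labelings P x ->
  pos_labelings P (rowmotion_along P L x).
Proof.
elim: L x => [//|p L IH] x LP xP; apply: (IH (toggle P p x)).
  by move=> a aL; apply: LP; rewrite inE aL orbT.
by apply: toggle_pos => //; apply: LP; rewrite mem_head.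
Qed.

Lemma rowmotion_alongK d (T : finPOrderType d) (R : realType)
    (P : {set T}) (L : seq T) (x : {ffun T -> R}) :
  {subset L <= P} -> pos_labelings P x ->
  rowmotion_along P (rev L) (rowmotion_along P L x) = x.
Proof.
elim: L x => [//|p L IH] x LP xP.
have pP : p \in P by apply: LP; rewrite mem_head.
have := IH (toggle P p x); rewrite rev_cons -cats1 /rowmotion_along foldl_cat /=.
move=> ->; [exact: toggleK | | exact: toggle_pos].
  by move=> a aL; apply: LP; rewrite inE aL orbT.
Qed.

Lemma rowmotion_bij d (T : finPOrderType d) (R : realType) (P : {set T}) :
  set_bij (pos_labelings P) (pos_labelings P) (@rowmotion d T R P).
Proof.
have [_ SP _] := std_extP P.
have SsP : {subset std_ext P <= P} by move=> p; rewrite SP.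
have RsP : {subset rev (std_ext P) <= P} by move=> p; rewrite mem_rev SP.
split.
- by move=> x; exact: rowmotion_along_pos.
- move=> x y /set_mem xP /set_mem yP eq_xy.
  rewrite -(rowmotion_alongK SsP xP) -(rowmotion_alongK SsP yP).
  by congr rowmotion_along.
- move=> y yP; exists (rowmotion_along P (rev (std_ext P)) y).
    exact: rowmotion_along_pos.
  by rewrite /rowmotion -{1}[std_ext P]revK rowmotion_alongK.
Qed.

(* The inverse performs the toggles in the opposite order. *)
Lemma rowmotion_invE d (T : finPOrderType d) (R : realType) (P : {set T})
    (L : seq T) (x : {ffun T -> R}) :
  linear_extension P L -> pos_labelings P x ->
  rowmotion_inv P x = rowmotion_along P (rev L) x.
Proof.
move=> extL xP; have [_ LP _] := extL.
have LsP : {subset L <= P} by move=> p; rewrite LP.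
have RsP : {subset rev L <= P} by move=> p; rewrite mem_rev LP.
have [_ inj _] := @rowmotion_bij _ _ R P.
have yP := rowmotion_along_pos RsP xP.
have xE : x = rowmotion P (rowmotion_along P (rev L) x).
  by rewrite (rowmotionE _ extL) -{1}[L]revK rowmotion_alongK.
by rewrite [in LHS]xE /rowmotion_inv pinvKV // inE.
Qed.

(* Coordinates are 1-based as in the paper: [grid r s] is
   {0, ..., r+s-1} x {0, ..., s} with the componentwise order, and the row and
   column of index 0 lie in none of the posets below. *)
Definition grid (r s : nat) : finPOrderType _ :=
  ('I_(r + s - 1).+1 *p 'I_s.+1)%type.

Definition pt (r s i j : nat) : grid r s := (inord i, inord j).

(* RT_{r,k}, for k <= s; the condition i - j < r, over the integers, is
   written i < r + j. *)
Definition right_trapezoid (r s k : nat) : {set grid r s} :=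
  [set p : grid r s | [&& (0 < p.1 <= r + k - 1)%N, (0 < p.2 <= k)%N
             & (p.1 < r + p.2)%N]].

Definition trapezoid (r s k : nat) : {set grid r s} :=
  [set p : grid r s in right_trapezoid r s k | (k < p.1 + p.2)%N].

Definition rectangle (r s : nat) : {set grid r s} :=
  [set p : grid r s | (0 < p.1 <= r)%N && (0 < p.2 <= s)%N].

(* The interval [(a,b),(c,d)] of RT_{r,s}; the endpoints are numbers because
   they need not lie in the grid (the interval is then empty). *)
Definition RT_interval (r s a b c d : nat) : {set grid r s} :=
  [set p : grid r s in right_trapezoid r s s |
    (a <= p.1 <= c)%N && (b <= p.2 <= d)%N].

Definition interm (r s k : nat) : {set grid r s} :=
  trapezoid r s k :|: RT_interval r s k k.+1 (r + k - 1) s.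

Lemma interm_1 r s : (0 < s)%N -> interm r s 1 = rectangle r s.
Proof.
move=> s0; apply/setP => p; rewrite !inE.
have := ltn_ord p.1; have := ltn_ord p.2; lia.
Qed.

Lemma interm_s r s : interm r s s = trapezoid r s s.
Proof.
apply/setP => p; rewrite !inE.
have := ltn_ord p.1; have := ltn_ord p.2; lia.
Qed.

(* The interval M_k. *)
Definition zeta_itv (r s k : nat) : {set grid r s} :=
  RT_interval r s k 1 (r + k) k.+1.

(* The last branch is not reached for [p] in [interm r s k]. *)
Definition zeta_step (R : realType) (r s k : nat)
    (x : {ffun grid r s -> R}) : {ffun grid r s -> R} :=
  let M := zeta_itv r s k in
  let xbar : {ffun grid r s -> R} :=
    [ffun p => if p == pt r s k 1 then 1 else x p] in
  [ffun p : grid r s =>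
    if p \in interm r s k :&: M then rowmotion_inv M xbar p
    else if (p \in interm r s k :\: M) && (k.+1 < p.2)%N
    then x (pt r s p.1.+1 p.2)
    else if (p \in interm r s k :\: M) && (p.1 < k)%N
    then x (pt r s p.1 p.2.+1)
    else x p].

Definition zeta (R : realType) (r s : nat) :
    {ffun grid r s -> R} -> {ffun grid r s -> R} :=
  \big[(fun f g => f \o g)/id]_(1 <= k < s) @zeta_step R r s k.

(* Main.v *)
(* The weight of all maximal chains of [I_k] is not preserved by the individual
   steps [zeta_k]. What is preserved is the weight of those maximal chains of
   [I_k] that start at [(k,1)] or meet the right border
   [(r,1), (r+1,2), ..., (r+k-1,k)]. On the rectangle and on the trapezoid this
   is every maximal chain, since their chains start at [(1,1)], respectively
   end at [(r+s-1,s)].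

   For a single step, let [y = rho^-1(xbar)] on [M_k] and let [D p] be the
   weight of the chains of [M_k] from the bottom up to [p] with respect to
   [xbar]. Rowmotion says exactly that the chains from [p] to the top have
   [y]-weight [1 / D p]. Hence both labelings are explicit in terms of [D], and
   the sums over paths for [x] and for [y] are related through partial sums,
   along an antidiagonal, of [x]-path sums weighted by [D]. Paths that avoid the
   border are counted by setting the labels on the border to [0]. *)

Require Import Defs.
From mathcomp Require Import all_boot all_order all_algebra zify ring.
From mathcomp Require Import boolp classical_sets functions reals.
(* Repeated so that the finite-set lemmas shadow their homonyms from [classical_sets]. *)
From mathcomp Require Import fintype finset.

Set Implicit Arguments.
Unset Strict Implicit.
Unset Printing Implicit Defensive.

Import Order.TTheory GRing.Theory Num.Theory.
Local Open Scope ring_scope.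

(** * Weights of maximal chains *)

Section MaxChains.
Context {d : Order.disp_t} {T : finPOrderType d} {R : realType}.
Implicit Types (P Q A B C : {set T}) (p q : T) (x : {ffun T -> R}).

Lemma chainP C :
  reflect {in C &, forall p q, (p >=< q)%O} (chain C).
Proof.
by apply: (iffP forall_inP) => [h p q pC qC|h p pC];
  [have /forall_inP := h p pC; apply | apply/forall_inP => q qC; apply: h].
Qed.

Lemma max_chainsP P C :
  reflect [/\ C \subset P, chain C &
    forall p, p \in P -> {in C, forall q, (p >=< q)%O} -> p \in C]
    (C \in max_chains P).
Proof.
rewrite inE; apply: (iffP maxsetP) => [[/andP[CP Cch] Cmax]|[CP Cch Cmax]].
  split=> // p pP pC; rewrite -(Cmax (p |: C)) ?setU11 ?subsetUr //.
  rewrite subUset sub1set pP CP; apply/chainP => a b.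
  move=> /setU1P[->|aC] /setU1P[->|bC]; rewrite ?comparablexx ?pC //.
    by rewrite comparable_sym pC.
  by move/chainP: Cch; apply.
split=> [|D /andP[DP Dch] CD]; first by rewrite CP.
apply/eqP; rewrite eqEsubset CD andbT; apply/subsetP => p pD.
apply: Cmax => [|q qC]; first exact: (subsetP DP).
by move/chainP: Dch; apply => //; apply: (subsetP CD).
Qed.

(** On the right, [p] is comparable to every element, so maximality alone forces it into the
    chain. *)
Lemma max_chains_through P p : p \in P ->
  [set C in max_chains P | p \in C] = max_chains [set q in P | (q >=< p)%O].
Proof.
move=> pP; apply/setP => C; rewrite in_set.
apply/andP/max_chainsP => [[/max_chainsP[CP Cch Cmax] pC]|[CP Cch Cmax]].
  split=> // [|q]; last by rewrite inE => /andP[qP _]; apply: Cmax.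
  apply/subsetP => q qC; rewrite inE (subsetP CP) //=.
  by move/chainP: Cch; apply.
have CE q : q \in C -> (q \in P) && (q >=< p)%O.
  by move=> /(subsetP CP); rewrite inE.
have pC : p \in C.
  by apply: Cmax => [|q /CE/andP[_]]; rewrite ?inE ?pP ?comparablexx // comparable_sym.
split=> //; apply/max_chainsP; split=> // [|q qP qC].
  by apply/subsetP => q /CE/andP[].
by apply: Cmax => //; rewrite inE qP qC.
Qed.

Lemma max_chains0 : max_chains (set0 : {set T}) = [set set0].
Proof.
apply/setP => C; rewrite in_set1; apply/max_chainsP/eqP => [[C0 _ _]|->].
  by apply/eqP; rewrite -subset0.
split=> [|| p]; rewrite ?sub0set ?inE //.
by apply/chainP => p q; rewrite inE.
Qed.

Lemma max_chains1 p : max_chains [set p] = [set [set p]].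
Proof.
apply/setP => C; rewrite in_set1; apply/max_chainsP/eqP => [[C1 _ Cmax]|->].
  apply/eqP; rewrite eqEsubset C1 sub1set; apply: Cmax; rewrite ?set11 //.
  by move=> q /(subsetP C1)/set1P->; exact: comparablexx.
split=> //; by apply/chainP => a b /set1P-> /set1P->; exact: comparablexx.
Qed.

Lemma weight0 x : weight (max_chains (set0 : {set T})) x = 1.
Proof. by rewrite /weight max_chains0 big_set1 big_set0. Qed.

Lemma weight1 p x : weight (max_chains [set p]) x = x p.
Proof. by rewrite /weight max_chains1 !big_set1. Qed.

(** A maximal chain [C] of the union corresponds to the pair of [C :&: A] and [C :&: B]. Full
    comparability across the two sets lets the two halves be chosen independently. *)
Lemma weight_join A B x : [disjoint A & B] ->
  {in A & B, forall a b, (a >=< b)%O} ->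
  weight (max_chains (A :|: B)) x =
  weight (max_chains A) x * weight (max_chains B) x.
Proof.
move=> dAB cAB; rewrite /weight big_distrlr /=.
have AB0 : A :&: B = set0 by apply/eqP; rewrite setI_eq0.
have split2 (C D : {set T}) : C \subset A -> D \subset B ->
    (C :|: D) :&: A = C /\ (C :|: D) :&: B = D.
  move=> CA DB; have DA0 : D :&: A = set0.
    by apply/eqP; rewrite -subset0 -AB0 setIC; apply: setIS.
  have CB0 : C :&: B = set0 by apply/eqP; rewrite -subset0 -AB0; apply: setSI.
  by rewrite !setIUl DA0 CB0 setU0 set0U (setIidPl CA) (setIidPl DB).
rewrite pair_big_dep /=.
rewrite (reindex_onto (fun CD : {set T} * {set T} => CD.1 :|: CD.2)
                      (fun C => (C :&: A, C :&: B))) /=; last first.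
  move=> C /max_chainsP[CP _ _]; rewrite -setIUr.
  exact/setIidPl.
apply: eq_big => [[C D]|[C D]] /=.
  apply/andP/andP => [[/max_chainsP[CDP CDch CDmax] /eqP[eC eD]]|].
    move: (C :|: D) CDP CDch CDmax eC eD => E CDP CDch CDmax <- <-.
    have EAB q : q \in E -> (q \in A) || (q \in B).
      by move=> /(subsetP CDP); rewrite inE.
    have chE X : chain (E :&: X).
      apply/chainP => a b /setIP[aE _] /setIP[bE _].
      by move/chainP: CDch; apply.
    split; apply/max_chainsP; split=> //; rewrite ?subsetIr // => p pX pE.
      rewrite inE pX andbT; apply: CDmax => [|q qE]; first by rewrite inE pX.
      case/orP: (EAB q qE) => qX; last exact: cAB.
      by apply: pE; rewrite inE qE.
    rewrite inE pX andbT; apply: CDmax => [|q qE]; first by rewrite inE pX orbT.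
    case/orP: (EAB q qE) => qX; first by rewrite comparable_sym; exact: cAB.
    by apply: pE; rewrite inE qE.
  move=> [/max_chainsP[CA Cch Cmax] /max_chainsP[DB Dch Dmax]].
  have [-> ->] := split2 _ _ CA DB; split=> //.
  apply/max_chainsP; split; first exact: setUSS.
    apply/chainP => a b /setUP[aC|aD] /setUP[bC|bD].
    - by move/chainP: Cch; apply.
    - by apply: cAB; [apply: (subsetP CA)|apply: (subsetP DB)].
    - rewrite comparable_sym.
      by apply: cAB; [apply: (subsetP CA)|apply: (subsetP DB)].
    - by move/chainP: Dch; apply.
  move=> p /setUP[pA|pB] pCD; rewrite inE.
    by rewrite Cmax // => q qC; apply: pCD; rewrite inE qC.
  by rewrite [p \in D]Dmax ?orbT // => q qD; apply: pCD; rewrite inE qD orbT.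
move=> /andP[/max_chainsP[CDP _ _] /eqP[eC eD]].
rewrite (eq_bigl [predU C & D]) => [|p]; last by rewrite !inE.
by rewrite bigU // -setI_eq0 -eC -eD setIACA AB0 setI0.
Qed.

Definition up_set P p : {set T} := [set q in P | (p <= q)%O].
Definition strict_up_set P p : {set T} := [set q in P | (p < q)%O].
Definition down_set P p : {set T} := [set q in P | (q <= p)%O].
Definition strict_down_set P p : {set T} := [set q in P | (q < p)%O].

Lemma weight_up_set P p x : p \in P ->
  weight (max_chains (up_set P p)) x = x p * weight (max_chains (strict_up_set P p)) x.
Proof.
move=> pP; rewrite -weight1 -weight_join.
- congr (weight (max_chains _) x); apply/setP => q; rewrite !inE.
  case: (eqVneq q p) => [->|qp] /=; first by rewrite lexx pP.
  by rewrite lt_neqAle eq_sym qp.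
- by rewrite disjoints1 inE ltxx andbF.
- by move=> a b /set1P-> ; rewrite inE => /andP[_ /ltW ab]; rewrite /Order.comparable ab.
Qed.

Lemma weight_through P p x : p \in P ->
  weight [set C in max_chains P | p \in C] x =
  weight (max_chains (strict_down_set P p)) x *
  (x p * weight (max_chains (strict_up_set P p)) x).
Proof.
move=> pP; rewrite -weight_up_set // max_chains_through // -weight_join.
- congr (weight (max_chains _) x); apply/setP => q; rewrite !inE -andb_orr.
  by congr (_ && _); rewrite /Order.comparable le_eqVlt; case: (comparableP p q).
- rewrite disjoint_subset; apply/subsetP => q; rewrite !inE => /andP[_ qp].
  by rewrite (lt_geF qp) andbF.
- move=> a b; rewrite !inE => /andP[_ ap] /andP[_ pb].
  by rewrite /Order.comparable (le_trans (ltW ap) pb).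
Qed.

(** The hypotheses make [A] the set of minimal elements. Every maximal chain contains exactly one of
    them: some [a] in [A] lies below the least element of the chain, so it belongs to the chain by
    maximality, and it is unique because [A] is an antichain. *)
Lemma weight_sum_minimal P A x : P != set0 -> A \subset P ->
  {in A &, forall a b, (a <= b)%O -> a = b} ->
  {in P, forall p, exists2 a, a \in A & (a <= p)%O} ->
  weight (max_chains P) x = \sum_(a in A) weight (max_chains (up_set P a)) x.
Proof.
move=> P0 AP anti Alow.
have through a : a \in A -> max_chains (up_set P a) = [set C in max_chains P | a \in C].
  move=> aA; rewrite max_chains_through ?(subsetP AP) //.
  congr max_chains; apply/setP => q; rewrite !inE.
  case: (boolP (q \in P)) => //= qP; rewrite /Order.comparable.
  case: (boolP (a <= q)%O) => [|naq]; rewrite ?orbT ?orbF //.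
  apply/esym/negbTE; apply: contra naq => qa.
  have [b bA bq] := Alow q qP.
  by rewrite -(anti _ _ bA aA (le_trans bq qa)).
rewrite (eq_bigr (fun a => weight [set C in max_chains P | a \in C] x)); last first.
  by move=> a aA; rewrite through.
rewrite /weight (exchange_big_dep (mem (max_chains P))) /=; last first.
  by move=> a C _; rewrite inE => /andP[].
apply: eq_bigr => C CM; have /max_chainsP[CP Cch Cmax] := CM.
have C0 : C != set0.
  apply: contraNneq P0 => C0; rewrite -subset0; apply/subsetP => q qP.
  by rewrite -C0; apply: Cmax => // z; rewrite C0 inE.
have [m mC mmin] : exists2 m, m \in C & {in C, forall q, (m <= q)%O}.
  have [q0 q0C] := set0Pn _ C0.
  (* A member of the chain whose principal ideal in [T] is smallest is the least element of the
     chain. *)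
  case: (arg_minnP (fun m => #|[set z | (z <= m)%O]|) q0C) => m mC mmin.
  exists m => // q qC; move/chainP: Cch => /(_ q m qC mC)/orP[|//] qm.
  case: (eqVneq q m) => [->//|nqm].
  have := mmin q qC; rewrite leqNgt => /negP[]; apply: proper_card.
  apply/properP; split.
    by apply/subsetP => z; rewrite !inE => /le_trans; apply.
  by exists m; rewrite !inE ?lexx // lt_geF // lt_neqAle nqm.
have [a aA am] := Alow m (subsetP CP _ mC).
have aC : a \in C.
  apply: Cmax => [|q /mmin mq]; first exact: (subsetP AP).
  by rewrite /Order.comparable (le_trans am mq).
rewrite [RHS](big_pred1 a) // => b; rewrite in_set CM /=.
apply/andP/eqP => [[bA bC]|->//].
move/chainP: Cch => /(_ a b aC bC)/orP[ab|ba]; first by rewrite (anti _ _ aA bA ab).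
exact: anti.
Qed.

End MaxChains.

(** * Recursion of chain weights along covers *)

Section CoverRecursion.
Context {d : Order.disp_t} {T : finPOrderType d} {R : realType}.
Implicit Types (P Q A B C : {set T}) (p q : T) (x : {ffun T -> R}).

(** The value 0 outside [P] lets a sum over covers include positions that are missing from [P]. *)
Definition up_weight P x p : R :=
  if p \in P then weight (max_chains (up_set P p)) x else 0.
Definition down_weight P x p : R :=
  if p \in P then weight (max_chains (down_set P p)) x else 0.

(** The points [a] and [b] are the possible covers of [p]; either may be missing, which is why the
    conditions on them are guarded. Those present are the minimal elements of the strict up-set. If
    neither is, only the empty chain lies above [p], and its weight is 1. *)
Lemma up_weight_two_covers P x p a b : p \in P -> a != b ->
  (a \in P -> b \in P -> ~~ (a >=< b)%O) ->
  (a \in P -> (p < a)%O) -> (b \in P -> (p < b)%O) ->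
  (forall q, q \in P -> (p < q)%O ->
     (a \in P) && (a <= q)%O \/ (b \in P) && (b <= q)%O) ->
  up_weight P x p = x p *
    (if (a \in P) || (b \in P) then up_weight P x a + up_weight P x b else 1).
Proof.
move=> pP neq_ab cab pa pb covers; rewrite {1}/up_weight pP weight_up_set //.
congr (_ * _); case: ifP => [abP|/negbT]; last first.
  rewrite negb_or => /andP[/negbTE aP /negbTE bP].
  suff -> : strict_up_set P p = set0 by rewrite weight0.
  apply/setP => q; rewrite !inE; apply/negbTE/negP => /andP[qP pq].
  by case: (covers q qP pq); rewrite ?aP ?bP.
pose A := [set c in P | c \in [:: a; b]].
have AS : A \subset strict_up_set P p.
  apply/subsetP => c; rewrite !inE => /andP[cP]; rewrite cP /=.
  by case/orP => /eqP cE; rewrite cE in cP *; auto.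
rewrite (@weight_sum_minimal _ _ _ _ A) //.
- rewrite (eq_bigr (up_weight P x)) => [|c cA]; last first.
    have := cA; rewrite inE /up_weight => /andP[-> _].
    congr (weight (max_chains _) x); apply/setP => q; rewrite !inE -andbA.
    congr (_ && _); apply/andb_idl => cq; apply: lt_le_trans cq.
    by have := subsetP AS c cA; rewrite inE => /andP[].
  rewrite (eq_bigl (fun c => (c \in [:: a; b]) && (c \in P))); last first.
    by move=> c; rewrite in_set andbC.
  rewrite big_mkcondr (eq_bigr (up_weight P x)); last first.
    by move=> c _; rewrite /up_weight; case: (c \in P).
  by rewrite -big_uniq /= ?inE ?neq_ab // !big_cons big_nil addr0.
- case/orP: abP => cP; apply/set0Pn; [exists a|exists b]; rewrite inE cP; auto.
- move=> c e; rewrite !inE => /andP[cP /orP[]/eqP cE] /andP[eP /orP[]/eqP eE] ce.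
  + by rewrite cE eE.
  + by rewrite cE eE in cP eP ce; have := cab cP eP; rewrite /Order.comparable ce.
  + by rewrite cE eE in cP eP ce; have := cab eP cP; rewrite /Order.comparable ce orbT.
  + by rewrite cE eE.
- move=> q; rewrite inE => /andP[qP pq].
  by case: (covers q qP pq) => /andP[cP cq]; [exists a|exists b]; rewrite // !inE cP eqxx ?orbT.
Qed.

End CoverRecursion.

(** Comparability is symmetric, so chains do not see the direction of the order. This transfers
    results on up-sets to down-sets. *)
Lemma max_chains_dual d (T : finPOrderType d) (P : {set T}) :
  @max_chains _ T^d P = max_chains P.
Proof.
have chain_dual (C : {set T}) : @chain _ T^d C = chain C.
  apply: eq_forallb => p; congr (_ ==> _); apply: eq_forallb => q.
  by congr (_ ==> _); exact: orbC.
apply/setP => C; rewrite !in_set; apply: maxset_eq => D.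
by rewrite chain_dual.
Qed.

(** * Rowmotion *)

Section Rowmotion.
Context {d : Order.disp_t} {T : finPOrderType d} {R : realType}.
Implicit Types (P Q A B C : {set T}) (p q : T) (x y : {ffun T -> R}).

Lemma down_weight_dual P x p : down_weight P x p = @up_weight _ T^d R P x p.
Proof.
rewrite /down_weight /up_weight max_chains_dual.
by congr (if _ then weight (max_chains _) x else 0).
Qed.

Lemma down_weight_two_covers P x p a b : p \in P -> a != b ->
  (a \in P -> b \in P -> ~~ (a >=< b)%O) ->
  (a \in P -> (a < p)%O) -> (b \in P -> (b < p)%O) ->
  (forall q, q \in P -> (q < p)%O ->
     (a \in P) && (q <= a)%O \/ (b \in P) && (q <= b)%O) ->
  down_weight P x p = x p *
    (if (a \in P) || (b \in P) then down_weight P x a + down_weight P x b else 1).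
Proof.
move=> pP nab cab; rewrite !down_weight_dual; apply: (@up_weight_two_covers _ T^d) => //.
by move=> aP bP; rewrite comparable_sym; apply: cab.
Qed.

Lemma eq_weight (P : {set T}) x y : {in P, x =1 y} ->
  weight (max_chains P) x = weight (max_chains P) y.
Proof.
move=> xy; apply: eq_bigr => C /max_chainsP[CP _ _]; apply: eq_bigr => p pC.
by apply: xy; apply: (subsetP CP).
Qed.

Lemma weight_down_set P p x : p \in P ->
  weight (max_chains (down_set P p)) x = x p * weight (max_chains (strict_down_set P p)) x.
Proof.
move=> pP; rewrite -[max_chains (down_set P p)]max_chains_dual.
rewrite -[max_chains (strict_down_set P p)]max_chains_dual.
exact: (@weight_up_set _ T^d R P p x pP).
Qed.

Lemma rowmotion_along_notin P L x p : p \notin L -> rowmotion_along P L x p = x p.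
Proof.
elim: L x => [//|q L IH] x; rewrite inE negb_or => /andP[pq pL].
by rewrite /rowmotion_along /= -/(rowmotion_along P L _) IH // ffunE (negPf pq).
Qed.

(* When [p] is toggled, the labels below [p] are already new and those above
   are still old. *)
Lemma rowmotion_down_up P y p : pos_labelings P y -> p \in P ->
  down_weight P (rowmotion P y) p * up_weight P y p = 1.
Proof.
move=> yP pP; rewrite /down_weight /up_weight pP weight_up_set // weight_down_set //.
have [uL LP Llt] := std_extP P.
rewrite /rowmotion; have pL : p \in std_ext P by rewrite LP.
case/splitPr: pL uL LP Llt => L1 L2 uL LP Llt.
have L1P : {subset L1 <= P} by move=> q qL; rewrite -LP mem_cat qL.
rewrite /rowmotion_along foldl_cat -/(rowmotion_along P L1 y).
set z := rowmotion_along P L1 y; rewrite -/(rowmotion_along P (p :: L2) z).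
have zP : pos_labelings P z by apply: rowmotion_along_pos.
move: (uL); rewrite cat_uniq cons_uniq => /and3P[uL1 /hasPn hL /andP[pL2 _]].
have pL1 : p \notin L1 by apply: hL; rewrite mem_head.
have sdnE : weight (max_chains (strict_down_set P p)) (rowmotion_along P (p :: L2) z)
          = weight (max_chains (strict_down_set P p)) z.
  apply: eq_weight => q; rewrite inE => /andP[qP qp].
  apply: rowmotion_along_notin; apply: contraL (Llt q p qP pP qp) => qL.
  rewrite -leqNgt !index_cat (negPf pL1) (negPf (hL q qL)) leq_add2l /=.
  by rewrite eqxx.
have supE : weight (max_chains (strict_up_set P p)) y
          = weight (max_chains (strict_up_set P p)) z.
  apply: eq_weight => q; rewrite inE => /andP[qP pq].
  rewrite /z rowmotion_along_notin //; apply: contraL (Llt p q pP qP pq) => qL.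
  rewrite -leqNgt !index_cat (negPf pL1) qL (leq_trans (index_size _ _)) //.
  exact: leq_addr.
have -> : y p = z p by rewrite /z rowmotion_along_notin.
rewrite sdnE supE.
have -> : rowmotion_along P (p :: L2) z p = toggle P p z p.
  exact: (@rowmotion_along_notin P L2 (toggle P p z) p pL2).
rewrite ffunE eqxx.
have w0 := weight_gt0 zP pP.
(* By [weight_through], the factors besides the new label multiply to exactly the weight that the
   toggle inverts. *)
by rewrite -mulrA -weight_through // mulVf // gt_eqF.
Qed.

Lemma rowmotion_invK P x : pos_labelings P x ->
  pos_labelings P (rowmotion_inv P x) /\ rowmotion P (rowmotion_inv P x) = x.
Proof.
move=> xP; have E := std_extP P; have [_ LP _] := E.
have LsP : {subset std_ext P <= P} by move=> p; rewrite LP.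
have RsP : {subset rev (std_ext P) <= P} by move=> p; rewrite mem_rev LP.
rewrite (rowmotion_invE E xP); split; first exact: rowmotion_along_pos.
by rewrite /rowmotion -{1}[std_ext P]revK rowmotion_alongK.
Qed.

End Rowmotion.

(** * Shifting path sums *)

Section ChainShift.
Variables (F : realFieldType) (r k : nat).
Hypotheses (k_gt0 : (0 < k)%N) (lt_kr : (k < r)%N).
(* [U] and [V] stand for the sums over paths from [(i,j)] to the top of [I_{k+1}]
   and of [I_k], [U0] and [V0] for those that avoid the border. *)
Variables D x y U U0 V V0 : nat -> nat -> F.

Let inM i j := [&& (k <= i)%N, (0 < j <= k.+1)%N & (i < r + j)%N].
Let bd i j := (r + j == i.+1)%N.
Let dU i j := U i j - U0 i j.
Let dV i j := V i j - V0 i j.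

Hypothesis D_out : forall i j, ~~ inM i j -> D i j = 0.
Hypothesis D_gt0 : forall i j, inM i j -> 0 < D i j.
Hypothesis D_min : D k 1 = 1.
Hypothesis D_rec : forall i j, inM i j -> (k.+1 < i + j)%N ->
  D i j = x i j * (D i.-1 j + D i j.-1).
(** This is the cover recursion for the [y]-weights [1 / D] of chains going up. Since [D] is 0 off
    [M_k] and the inverse of 0 is 0, a missing cover contributes nothing. *)
Hypothesis y_rec : forall i j, inM i j -> (i + j < r + k + k.+1)%N ->
  y i j * D i j * ((D i.+1 j)^-1 + (D i j.+1)^-1) = 1.
Hypothesis U_out : forall i j, (j <= k.+1)%N -> (r + j <= i)%N -> U i j = 0.
Hypothesis U_rec : forall i j, inM i j -> (k.+1 < i + j)%N ->
  U i j = x i j * (U i.+1 j + U i j.+1).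
Hypothesis U0_rec : forall i j, inM i j -> (k.+1 < i + j)%N ->
  U0 i j = if bd i j then 0 else x i j * (U0 i.+1 j + U0 i j.+1).
Hypothesis U0_top : forall i j, (k.+1 < j)%N -> U0 i j = U i j.
(** The [minn] is needed because row [k + 1] of [I_k] stops one point before the top
    [(r + k, k + 1)] of [M_k]. *)
Hypothesis V_out : forall i j, (j <= k.+1)%N -> (r + minn j k <= i)%N -> V i j = 0.
Hypothesis V0_out : forall i j, (j <= k.+1)%N -> (r + minn j k <= i)%N -> V0 i j = 0.
Hypothesis V_rec : forall i j, inM i j -> (i + j < r + k + k.+1)%N ->
  V i j = y i j * (V i.+1 j + V i j.+1).
Hypothesis V0_rec : forall i j, inM i j -> (i + j < r + k + k.+1)%N ->
  V0 i j = if bd i j then 0 else y i j * (V0 i.+1 j + V0 i j.+1).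
Hypothesis V_top : forall i, V i k.+2 = U i.+1 k.+2.
Hypothesis V0_top : forall i, V0 i k.+2 = U i.+1 k.+2.

Let S i j := D i.-1 j + D i j.-1.

(* The antidiagonal of rank [i + j + 1] is cut between [(i, j+1)] and
   [(i+1, j)]; each function sums over the part on its side of the cut. *)
Fixpoint sum_right i j :=
  if j is j'.+1 then S i.+1 j * U i.+1 j + sum_right i.+1 j' else 0.
Fixpoint sum_left i j :=
  if i is i'.+1 then S i j.+1 * dU i j.+1 + sum_left i' j.+1 else 0.

(** As [D = x * S], multiplying by [S] trades the label [x] for [D]. Off [M_k] both sides vanish. *)
Let SU i j : (k < i)%N -> (0 < j <= k.+1)%N ->
  S i j * U i j = D i j * (U i.+1 j + U i j.+1).
Proof.
move=> ki jk; case: (boolP (inM i j)) => [ij|nij].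
  by rewrite (@U_rec i j) 1?(@D_rec i j) //; [rewrite /S; ring | lia | lia].
by rewrite D_out // U_out ?mulr0 ?mul0r //; move: nij; rewrite /inM; lia.
Qed.

(** By [SU] every term is pushed to its two upper neighbours. Regrouping by upper point restores the
    coefficients [S]; what remains is the one step, from [(i+1, j)] to [(i+1, j+1)], that crosses
    the new cut. *)
Let sum_rightE i j : (k <= i)%N -> (j <= k.+1)%N ->
  sum_right i j = sum_right i.+1 j + D i.+1 j * U i.+1 j.+1.
Proof.
elim: j i => [|j IH] i ki jk /=.
  by rewrite D_out ?mul0r ?addr0 // /inM; lia.
rewrite SU; [|lia|lia]; rewrite (IH i.+1); [|lia|lia].
by rewrite {1}/S /=; ring.
Qed.

Let sum_right_out i j : (r + j <= i.+1)%N -> (j <= k.+1)%N -> sum_right i j = 0.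
Proof.
elim: j i => [//|j IH] i ij jk /=.
by rewrite IH ?U_out ?mulr0 ?addr0 //; lia.
Qed.

(** The first condition keeps [(i, j)] off the border, where [U0] is cut to 0 and the difference has
    no such recursion. *)
Let SdU i j : (i.+1 < r + j)%N -> (1 < j)%N ->
  S i j * dU i j = D i j * (dU i.+1 j + dU i j.+1).
Proof.
move=> ij j1; case: (leqP j k.+1) => jk; last first.
  by rewrite /dU !U0_top ?subrr ?mulr0 ?addr0 ?mulr0 //; lia.
case: (ltnP i k) => ik.
  by rewrite /S !D_out ?addr0 ?mul0r // /inM; lia.
have ijM : inM i j by rewrite /inM; lia.
rewrite /dU (@U_rec i j) 1?(@U0_rec i j) 1?(@D_rec i j) //; try lia.
by have -> : bd i j = false; [rewrite /bd; lia | rewrite /S; ring].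
Qed.

(** Mirror image of [sum_rightE]: the step from [(i, j+1)] to [(i+1, j+1)] crosses the cut. *)
Let sum_leftE i j : (i < r + j)%N -> (0 < j)%N ->
  sum_left i j = sum_left i j.+1 + D i j.+1 * dU i.+1 j.+1.
Proof.
elim: i j => [|i IH] j ij j0 /=.
  by rewrite D_out ?mul0r ?addr0 // /inM; lia.
rewrite SdU; [|lia|lia]; rewrite (IH j.+1); [|lia|lia].
by rewrite {1}/S /=; ring.
Qed.

Let sum_left_top i j : (k < j)%N -> sum_left i j = 0.
Proof.
elim: i j => [//|i IH] j kj /=.
by rewrite /dU U0_top ?subrr ?mulr0 ?add0r ?IH //; lia.
Qed.

Let sum_left_out i j : (i < k)%N -> sum_left i j = 0.
Proof.
elim: i j => [//|i IH] j ik /=.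
by rewrite IH ?addr0 /S ?D_out ?addr0 ?mul0r // /inM; lia.
Qed.

(** By [y_rec], [y * D] is the inverse of the sum of the inverses of the two upper values of [D]. So
    the quantity at [(i, j)] is a weighted average of the same quantities [D * a] and [D * b] at the
    upper neighbours, with total weight [S i.+1 j.+1]. *)
Let y_step i j a b : inM i j -> (i.+1 < r + j)%N -> (j <= k)%N ->
  D i j * (y i j * (a + b)) =
  (D i j.+1 * (D i.+1 j * a) + D i.+1 j * (D i j.+1 * b)) / S i.+1 j.+1.
Proof.
move=> ijM ij jk; rewrite /S /=.
have d1 : 0 < D i.+1 j by apply: D_gt0; move: ijM; rewrite /inM; lia.
have d2 : 0 < D i j.+1 by apply: D_gt0; move: ijM; rewrite /inM; lia.
have yE : y i j * D i j * ((D i.+1 j)^-1 + (D i j.+1)^-1) = 1.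
  by apply: y_rec => //; lia.
have -> : D i j * (y i j * (a + b)) = (y i j * D i j) * (a + b) by ring.
have -> : y i j * D i j = ((D i.+1 j)^-1 + (D i j.+1)^-1)^-1.
  have n0 : (D i.+1 j)^-1 + (D i j.+1)^-1 != 0.
    by rewrite gt_eqF // addr_gt0 // invr_gt0.
  by apply: (mulIf n0); rewrite yE mulVf.
by field; rewrite !gt_eqF // ?addr_gt0.
Qed.

(** On row [k + 1] and, in [y_step2], on the border, a point has a single cover in [M_k], so the
    average has one term. *)
Let y_step1 i : (k <= i)%N -> (i < r + k)%N ->
  D i k.+1 * y i k.+1 = D i.+1 k.+1.
Proof.
move=> ki ik.
have d : 0 < D i.+1 k.+1 by apply: D_gt0; rewrite /inM; lia.
have yE : y i k.+1 * D i k.+1 * ((D i.+1 k.+1)^-1 + (D i k.+2)^-1) = 1.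
  by apply: y_rec; rewrite /inM; lia.
have Dk : D i k.+2 = 0 by apply: D_out; rewrite /inM; lia.
rewrite Dk invr0 addr0 in yE.
by apply: (mulIf (invr_neq0 (lt0r_neq0 d)));
  rewrite mulfV ?lt0r_neq0 // mulrC mulrA -yE; ring.
Qed.

Let y_step2 j : (0 < j <= k)%N ->
  D (r + j).-1 j * y (r + j).-1 j = D (r + j).-1 j.+1.
Proof.
move=> jk.
have d : 0 < D (r + j).-1 j.+1 by apply: D_gt0; rewrite /inM; lia.
have yE : y (r + j).-1 j * D (r + j).-1 j *
    ((D (r + j).-1.+1 j)^-1 + (D (r + j).-1 j.+1)^-1) = 1.
  by apply: y_rec; rewrite /inM; lia.
have Dk : D (r + j).-1.+1 j = 0 by apply: D_out; rewrite /inM; lia.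
rewrite Dk invr0 add0r in yE.
by apply: (mulIf (invr_neq0 (lt0r_neq0 d)));
  rewrite mulfV ?lt0r_neq0 // mulrC mulrA -yE; ring.
Qed.

Let S_gt0 i j : inM i j -> (k.+1 < i + j)%N -> 0 < S i j.
Proof.
move=> ij /(D_rec ij) e; have d := D_gt0 ij; rewrite e in d.
rewrite lt_def; apply/andP; split.
  by apply: contraTneq d; rewrite -/(S i j) => ->; rewrite mulr0 ltxx.
have D_ge0 a b : 0 <= D a b.
  by case: (boolP (inM a b)) => [/D_gt0/ltW|/D_out->].
by rewrite addr_ge0.
Qed.

(** Descending induction on the rank. At an interior point the inductive values at [(i+1, j)] and
    [(i, j+1)] differ by a single term at [(i+1, j+1)]; their weighted average from [y_step]
    therefore adds precisely the crossing term of [sum_rightE] or [sum_leftE]. *)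
Lemma path_sums_antidiagonal i j : inM i j ->
  D i j * V0 i j = sum_right i j /\ D i j * dV i j = sum_left i j.
Proof.
move En : (r + k + k.+1 - (i + j))%N => n.
elim: n i j En => [|n IH] i j En ijM.
  (* The only point left is the top [(r + k, k + 1)] of [M_k]. It lies outside [I_k], so all terms
     are 0. *)
  move: (ijM); rewrite /inM => ijM'; rewrite /dV V_out ?V0_out ?subrr ?mulr0; try lia.
  by rewrite sum_right_out ?sum_left_top //; lia.
move: (ijM); rewrite /inM => ijM'.
case: (boolP (bd i j)) => [ijb|nijb].
  (* On the border [V0] is 0 and the whole of [V] comes from [(i, j+1)], both its avoiding and its
     touching part. The avoiding part equals the crossing term of [sum_leftE], because [(i+1, j+1)]
     is again a border point and [dU] is [U] there. *)
  move: (ijb); rewrite /bd => ijb'.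
  have iE : i = (r + j).-1 by lia.
  have V00 : V0 i j = 0 by rewrite V0_rec ?ijb //; lia.
  rewrite V00 mulr0 sum_right_out; [|lia|lia]; split => //.
  rewrite /dV V00 subr0 V_rec //; last by lia.
  rewrite (V_out (i := i.+1)) ?add0r; [|lia|lia].
  rewrite mulrA {2}iE iE y_step2; last by lia.
  have [] := IH (r + j).-1 j.+1; [lia | rewrite /inM; lia |].
  move=> e1 e2; have -> : V (r + j).-1 j.+1 = V0 (r + j).-1 j.+1 + dV (r + j).-1 j.+1.
    by rewrite /dV; ring.
  rewrite mulrDr e1 e2 (@sum_leftE (r + j).-1 j); [|lia|lia].
  rewrite /= sum_right_out ?addr0; [|lia|lia].
  rewrite /dU (@U0_rec (r + j).-1.+1 j.+1); [|rewrite /inM; lia|lia].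
  have -> : bd (r + j).-1.+1 j.+1 by rewrite /bd; lia.
  rewrite /S subr0 /= (@D_out (r + j).-1.+1 j); first by ring.
  by rewrite /inM; lia.
case: (ltnP j k.+1) => jk; last first.
  (* Paths leaving row [k + 1] upwards no longer meet the border, so they enter [V0] but cancel in
     [dV]. *)
  have {}jk : j = k.+1 by lia.
  move: nijb; rewrite jk /bd => nijb.
  have VE : V0 i k.+1 = y i k.+1 * (V0 i.+1 k.+1 + V0 i k.+2).
    rewrite V0_rec -?jk //; last by lia.
    by have -> : bd i j = false by rewrite /bd; lia.
  have dVE : dV i k.+1 = y i k.+1 * dV i.+1 k.+1.
    rewrite /dV VE V_rec -?jk //; last by lia.
    by rewrite jk V_top V0_top; ring.
  have [] := IH i.+1 k.+1; [lia | rewrite /inM; lia |] => e1 e2.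
  rewrite VE dVE !mulrA !y_step1; [|lia|lia].
  by rewrite mulrDr e1 e2 !sum_left_top // (@sum_rightE i k.+1) ?V0_top //; lia.
have jk' : (j <= k)%N by [].
have nb : (i.+1 < r + j)%N by move: nijb; rewrite /bd; lia.
have dVE : dV i j = y i j * (dV i.+1 j + dV i j.+1).
  rewrite /dV V_rec 1?(@V0_rec i j) // ?(negPf nijb); try lia.
  by ring.
have [] := IH i.+1 j; [lia | rewrite /inM; lia |] => e1 e2.
have [] := IH i j.+1; [lia | rewrite /inM; lia |] => f1 f2.
have S0 : S i.+1 j.+1 != 0 by rewrite gt_eqF // S_gt0 // /inM; lia.
split.
  rewrite V0_rec // ?(negPf nijb); last by lia.
  rewrite y_step // e1 f1 (@sum_rightE i j); [|lia|lia].
  by apply: (mulIf S0); rewrite mulfVK // /S /= /S /=; ring.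
rewrite dVE y_step // e2 f2 (@sum_leftE i j); [|lia|lia].
by apply: (mulIf S0); rewrite mulfVK // /S /= /S /=; ring.
Qed.

(** Since [D] vanishes left of column [k], a single term survives, with [S k j.+1 = D k j]. *)
Let sum_left_k j : (0 < j <= k)%N -> sum_left k j = D k j * dU k j.+1.
Proof.
move=> jk; have -> : sum_left k j = S k j.+1 * dU k j.+1 + sum_left k.-1 j.+1.
  by rewrite -[in LHS](prednK k_gt0) /= prednK.
rewrite sum_left_out ?addr0 /S /=; last by lia.
by rewrite [D k.-1 _]D_out ?add0r // /inM; lia.
Qed.

(** At [(k, 1)] both cut sums have one term, with coefficient [D k 1 = 1]. The avoiding paths
    account for the start [(k+1, 1)], the touching ones for the start [(k, 2)]. *)
Lemma path_sum_corner : V k 1 = U k.+1 1 + (U k 2 - U0 k 2).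
Proof.
have [|e1 e2] := @path_sums_antidiagonal k 1; first by rewrite /inM; lia.
have -> : V k 1 = V0 k 1 + dV k 1 by rewrite /dV; ring.
rewrite sum_left_k ?D_min ?mul1r in e1 e2; last by lia.
rewrite e1 e2 /= /S /= D_min D_out ?addr0 ?mul1r // /inM; lia.
Qed.

Lemma path_sum_column j : (1 < j <= k)%N -> V k j - V0 k j = U k j.+1 - U0 k j.+1.
Proof.
move=> jk; have [|_] := @path_sums_antidiagonal k j; first by rewrite /inM; lia.
have d : 0 < D k j by apply: D_gt0; rewrite /inM; lia.
by rewrite sum_left_k ?(ltnW jk) //; [move=> /(mulfI (lt0r_neq0 d)) | lia].
Qed.

End ChainShift.

(** * The intermediate posets *)

Section Grid.
Variables (R : realType) (r s : nat).
Hypotheses (s_gt0 : (0 < s)%N) (le_sr : (s <= r)%N).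
Local Notation pt := (pt r s).
Implicit Types (P : {set grid r s}) (z : {ffun grid r s -> R}).

Lemma pt1 i j : (pt i j).1 = (if (i < r + s)%N then i else 0%N) :> nat.
Proof.
rewrite /= /inord val_insubd.
by have -> : (i < (r + s - 1).+1)%N = (i < r + s)%N by lia.
Qed.

Lemma pt2 i j : (pt i j).2 = (if (j <= s)%N then j else 0%N) :> nat.
Proof. by rewrite /= /inord val_insubd /=. Qed.

Lemma ptE (p : grid r s) : pt p.1 p.2 = p.
Proof. by case: p => a b; rewrite /Defs.pt /= !inord_val. Qed.

Lemma grid_leE (p q : grid r s) : (p <= q)%O = (p.1 <= q.1)%N && (p.2 <= q.2)%N.
Proof. by []. Qed.

Lemma grid_eqE (p q : grid r s) :
  (p == q) = (p.1 == q.1 :> nat) && (p.2 == q.2 :> nat).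
Proof. by []. Qed.

Lemma grid_ltE (p q : grid r s) :
  (p < q)%O = [&& (p.1 <= q.1)%N, (p.2 <= q.2)%N & (p.1 + p.2 < q.1 + q.2)%N].
Proof. by rewrite lt_neqAle grid_leE grid_eqE; lia. Qed.

(** Out-of-range indices are sent to 0 by [pt]. Off the axes, [pt i j \in P] thus guarantees that
    [i] and [j] are the true coordinates. *)
Definition off_axes P := forall p, p \in P -> (0 < p.1)%N && (0 < p.2)%N.

Lemma off_axes_pt P i j : off_axes P -> pt i j \in P ->
  (0 < i < r + s)%N && (0 < j <= s)%N.
Proof. by move=> ax /ax; rewrite pt1 pt2; do 2?case: ifP; lia. Qed.

Lemma up_weight_pt P z i j : off_axes P -> pt i j \in P ->
  (forall a b, pt a b \in P -> (i <= a)%N -> (j <= b)%N -> (i + j < a + b)%N ->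
    (i < a)%N && (pt i.+1 j \in P) || (j < b)%N && (pt i j.+1 \in P)) ->
  up_weight P z (pt i j) = z (pt i j) *
    (if (pt i.+1 j \in P) || (pt i j.+1 \in P)
     then up_weight P z (pt i.+1 j) + up_weight P z (pt i j.+1) else 1).
Proof.
move=> ax pP cov; have ij := off_axes_pt ax pP.
apply: up_weight_two_covers => //.
- by rewrite grid_eqE !pt1 !pt2; (do ?case: ifP); lia.
- move=> /(off_axes_pt ax) h1 /(off_axes_pt ax) h2.
  by rewrite /Order.comparable !grid_leE !pt1 !pt2; (do ?case: ifP); lia.
- by move=> /(off_axes_pt ax) h1; rewrite grid_ltE !pt1 !pt2; (do ?case: ifP); lia.
- by move=> /(off_axes_pt ax) h1; rewrite grid_ltE !pt1 !pt2; (do ?case: ifP); lia.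
move=> q qP; rewrite -(ptE q) in qP *; have q12 := off_axes_pt ax qP.
rewrite grid_ltE !pt1 !pt2 => lt_pq0.
have {lt_pq0} lt_pq : [&& (i <= q.1)%N, (j <= q.2)%N & (i + j < q.1 + q.2)%N].
  by move: lt_pq0; (do ?case: ifP); lia.
have /orP[/andP[lt h]|/andP[lt h]] : (i < q.1)%N && (pt i.+1 j \in P)
    || (j < q.2)%N && (pt i j.+1 \in P) by apply: cov => //; lia.
  by left; rewrite h grid_leE !pt1 !pt2; (do ?case: ifP); lia.
by right; rewrite h grid_leE !pt1 !pt2; (do ?case: ifP); lia.
Qed.

Lemma down_weight_pt P z i j : off_axes P -> pt i j \in P ->
  (forall a b, pt a b \in P -> (a <= i)%N -> (b <= j)%N -> (a + b < i + j)%N ->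
    (a < i)%N && (pt i.-1 j \in P) || (b < j)%N && (pt i j.-1 \in P)) ->
  down_weight P z (pt i j) = z (pt i j) *
    (if (pt i.-1 j \in P) || (pt i j.-1 \in P)
     then down_weight P z (pt i.-1 j) + down_weight P z (pt i j.-1) else 1).
Proof.
move=> ax pP cov; have ij := off_axes_pt ax pP.
apply: down_weight_two_covers => //.
- by rewrite grid_eqE !pt1 !pt2; (do ?case: ifP); lia.
- move=> /(off_axes_pt ax) h1 /(off_axes_pt ax) h2.
  by rewrite /Order.comparable !grid_leE !pt1 !pt2; (do ?case: ifP); lia.
- by move=> /(off_axes_pt ax) h1; rewrite grid_ltE !pt1 !pt2; (do ?case: ifP); lia.
- by move=> /(off_axes_pt ax) h1; rewrite grid_ltE !pt1 !pt2; (do ?case: ifP); lia.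
move=> q qP; rewrite -(ptE q) in qP *; have q12 := off_axes_pt ax qP.
rewrite grid_ltE !pt1 !pt2 => lt_pq0.
have {lt_pq0} lt_pq : [&& (q.1 <= i)%N, (q.2 <= j)%N & (q.1 + q.2 < i + j)%N].
  by move: lt_pq0; (do ?case: ifP); lia.
have /orP[/andP[lt h]|/andP[lt h]] : (q.1 < i)%N && (pt i.-1 j \in P)
    || (q.2 < j)%N && (pt i j.-1 \in P) by apply: cov => //; lia.
  by left; rewrite h grid_leE !pt1 !pt2; (do ?case: ifP); lia.
by right; rewrite h grid_leE !pt1 !pt2; (do ?case: ifP); lia.
Qed.

Lemma mem_interm k i j : (0 < k <= s)%N -> (pt i j \in interm r s k) =
  [&& (0 < i)%N, (0 < j <= s)%N, (j <= k)%N ==> (k < i + j)%N && (i < r + j)%N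
    & (k < j)%N ==> (k <= i < r + k)%N].
Proof.
move=> ks; rewrite !inE !pt1 !pt2; (do ?case: ifP); lia.
Qed.

Lemma mem_zeta_itv k i j : (0 < k < s)%N -> (pt i j \in zeta_itv r s k) =
  [&& (k <= i)%N, (0 < j <= k.+1)%N & (i < r + j)%N].
Proof.
move=> ks; rewrite !inE !pt1 !pt2; (do ?case: ifP); lia.
Qed.

Lemma off_axes_interm k : (0 < k <= s)%N -> off_axes (interm r s k).
Proof. by move=> ks p; rewrite -{1}(ptE p) mem_interm //; lia. Qed.

Lemma off_axes_zeta_itv k : (0 < k < s)%N -> off_axes (zeta_itv r s k).
Proof. by move=> ks p; rewrite -{1}(ptE p) mem_zeta_itv //; lia. Qed.

(* The fictitious row [s + 1] carries the value [1] above the maximum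
   [(r + k - 1, s)] of [I_k], so that the recursion has no terminal case. *)
Definition path_weight k z i j : R :=
  if j == s.+1 then (i.+1 == r + k)%N%:R else up_weight (interm r s k) z (pt i j).

Lemma path_weight_rec k z i j : (0 < k <= s)%N -> pt i j \in interm r s k ->
  path_weight k z i j = z (pt i j) * (path_weight k z i.+1 j + path_weight k z i j.+1).
Proof.
move=> ks ijI; have ij := off_axes_pt (off_axes_interm ks) ijI.
rewrite /path_weight eqSS; have -> : (j == s.+1) = false by lia.
rewrite up_weight_pt //; first last.
- by move=> a b; move: ijI; rewrite !mem_interm //; lia.
- exact: off_axes_interm.
congr (_ * _); case: ifP => [ijP|/negbT].
  (* For [j = s] the upper neighbour is fictitious: its [up_weight] is 0, and so is the indicator,
     as [(i, s)] is not the maximum. *)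
  case: eqP => // js; congr (_ + _).
  rewrite /up_weight [pt i j.+1 \in _]mem_interm //.
  by move: ijP; rewrite !mem_interm // => ijP; case: ifP; case: eqP => //; lia.
rewrite negb_or => /andP[a b].
have -> : up_weight (interm r s k) z (pt i.+1 j) = 0 by rewrite /up_weight (negPf a).
move: a b ijI; rewrite !mem_interm // => a b ijI.
by case: eqP; [case: eqP; rewrite ?add0r // |]; lia.
Qed.

Lemma path_weight_out k z i j : (0 < k <= s)%N -> (j <= s)%N ->
  pt i j \notin interm r s k -> path_weight k z i j = 0.
Proof.
move=> ks js ijI; rewrite /path_weight /up_weight (negPf ijI).
by case: eqP => // jE; lia.
Qed.

Definition kill_border k z : {ffun grid r s -> R} :=
  [ffun p : grid r s => if (p.2 <= k)%N && (r + p.2 == p.1.+1)%N then 0 else z p].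

Lemma kill_border_pt k z i j : (i < r + s)%N -> (j <= s)%N ->
  kill_border k z (pt i j) = if (j <= k)%N && (r + j == i.+1)%N then 0 else z (pt i j).
Proof. by move=> ir js; rewrite ffunE pt1 // pt2 ir js. Qed.

Lemma path_weight_kill_border k z i j : (0 < k <= s)%N -> (k < j)%N ->
  path_weight k (kill_border k z) i j = path_weight k z i j.
Proof.
move=> ks kj; rewrite /path_weight; case: eqP => // _; rewrite /up_weight; case: ifP => // ijI.
have ij := off_axes_pt (off_axes_interm ks) ijI.
apply: eq_weight => p; rewrite inE => /andP[_].
rewrite grid_leE pt1 // pt2 ffunE => pij.
have -> : (p.2 <= k)%N = false by move: pij; (do ?case: ifP); lia.
by [].
Qed.

(** Above row [k + 1], the poset [I_{k+1}] is [I_k] translated by one in the first coordinate, and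
    the fictitious row moves along with it. *)
Lemma path_weight_shift k z z' : (0 < k < s)%N ->
  (forall i j, (k.+1 < j <= s)%N -> pt i j \in interm r s k ->
     z (pt i j) = z' (pt i.+1 j)) ->
  forall i j, (k.+1 < j <= s.+1)%N ->
  path_weight k z i j = path_weight k.+1 z' i.+1 j.
Proof.
move=> ks zz' i j; have k1 : (0 < k <= s)%N by lia.
have k2 : (0 < k.+1 <= s)%N by lia.
move En : (r + s + s - (i + j))%N => n.
elim/ltn_ind: n i j En => n IH i j En kj.
case: (eqVneq j s.+1) => [js|js].
  by rewrite /path_weight js eqxx addnS eqSS.
case: (boolP (pt i j \in interm r s k)) => ijI; last first.
  rewrite !path_weight_out //; try lia.
  by move: ijI; rewrite !mem_interm //; lia.
have ijI' : pt i.+1 j \in interm r s k.+1 by move: ijI; rewrite !mem_interm //; lia.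
rewrite (@path_weight_rec k z i j) // (@path_weight_rec k.+1 z' i.+1 j) //.
rewrite zz' //; last by lia.
move: (ijI); rewrite mem_interm // => ij.
by congr (_ * (_ + _)); apply: IH (erefl _) _; lia.
Qed.

(* The weight of the chains that start at [(k,1)] or meet the border; the minimal
   elements of [I_k] are the points of the antidiagonal [i + j = k + 1]. *)
Definition touching_weight k z : R :=
  path_weight k z k 1 +
  \sum_(1 <= i < k) (path_weight k z i (k.+1 - i)%N
                     - path_weight k (kill_border k z) i (k.+1 - i)%N).

(** * Invariance under one step [zeta_k] *)

Section ZetaStep.
Variables (k : nat) (x : {ffun grid r s -> R}).
Hypotheses (ks : (0 < k < s)%N).
Hypothesis x_gt0 : pos_labelings (interm r s k.+1) x.

Let M := zeta_itv r s k.
Let xbar : {ffun grid r s -> R} := [ffun p => if p == pt k 1 then 1 else x p].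
Let y := rowmotion_inv M xbar.
Let z := zeta_step k x.

Let k1 : (0 < k <= s)%N. Proof. by lia. Qed.
Let k2 : (0 < k.+1 <= s)%N. Proof. by lia. Qed.

Let xbar_pt i j : pt i j \in M -> (k.+1 < i + j)%N -> xbar (pt i j) = x (pt i j).
Proof.
move=> ijM kij; have ij := off_axes_pt (off_axes_zeta_itv ks) ijM.
rewrite ffunE grid_eqE !pt1 // !pt2; case: ifP => //; (do ?case: ifP); lia.
Qed.

Let xbar_gt0 : pos_labelings M xbar.
Proof.
move=> p pM; have p0 := off_axes_zeta_itv ks pM.
case: (eqVneq p (pt k 1)) => [->|npk]; first by rewrite ffunE eqxx.
rewrite ffunE (negPf npk); apply: x_gt0.
move: pM npk; rewrite -{1 3}(ptE p) mem_zeta_itv // mem_interm // grid_eqE pt1 // pt2.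
by (do ?case: ifP); lia.
Qed.

Let y_gt0 : pos_labelings M y. Proof. by have [] := rowmotion_invK xbar_gt0. Qed.

Let z_M i j : pt i j \in M -> (i + j < r + k + k.+1)%N -> z (pt i j) = y (pt i j).
Proof.
move=> ijM ij; rewrite ffunE in_setI ijM andbT.
by have -> : pt i j \in interm r s k by move: ijM; rewrite mem_zeta_itv // mem_interm //; lia.
Qed.

Let z_top i j : (k.+1 < j <= s)%N -> pt i j \in interm r s k -> z (pt i j) = x (pt i.+1 j).
Proof.
move=> kj ijI; have ij := off_axes_pt (off_axes_interm k1) ijI.
have nM : pt i j \notin zeta_itv r s k by rewrite mem_zeta_itv //; lia.
have [ir js] : (i < r + s)%N /\ (j <= s)%N by lia.
rewrite ffunE in_setI in_setD (negPf nM) ijI pt1 pt2 ir js /= ifT //; lia.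
Qed.

Let z_left i j : (i < k)%N -> pt i j \in interm r s k -> z (pt i j) = x (pt i j.+1).
Proof.
move=> ik ijI; have ij := off_axes_pt (off_axes_interm k1) ijI.
have nM : pt i j \notin zeta_itv r s k by rewrite mem_zeta_itv //; lia.
have := ijI; rewrite mem_interm // => ijI'.
have [ir js] : (i < r + s)%N /\ (j <= s)%N by lia.
rewrite ffunE in_setI in_setD (negPf nM) ijI pt1 pt2 ir js ik /= ifF //; lia.
Qed.

Lemma zeta_step_gt0 : pos_labelings (interm r s k) z.
Proof.
move=> p; rewrite -(ptE p); set i := nat_of_ord p.1; set j := nat_of_ord p.2.
move=> pI; have := pI; rewrite mem_interm // => pI'.
case: (leqP k i) => ki; last first.
  by rewrite z_left // x_gt0 // mem_interm //; lia.
case: (leqP j k.+1) => jk; last first.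
  by rewrite z_top ?x_gt0 // ?mem_interm //; lia.
have pM : pt i j \in M by rewrite mem_zeta_itv //; lia.
by rewrite z_M ?y_gt0 //; lia.
Qed.

Let D i j := down_weight M xbar (pt i j).
Let U := path_weight k.+1 x.
Let U0 := path_weight k.+1 (kill_border k.+1 x).
Let V := path_weight k z.
Let V0 := path_weight k (kill_border k z).

Let pt_M i j : (pt i j \in M) = [&& (k <= i)%N, (0 < j <= k.+1)%N & (i < r + j)%N].
Proof. exact: mem_zeta_itv. Qed.

Let axM : off_axes M. Proof. exact: off_axes_zeta_itv. Qed.

Let D_out i j : pt i j \notin M -> D i j = 0.
Proof. by rewrite /D /down_weight => /negPf->. Qed.

Let DE i j : pt i j \in M -> D i j * up_weight M y (pt i j) = 1.
Proof.
by move=> ijM; have [_ yE] := rowmotion_invK xbar_gt0; rewrite /D -yE rowmotion_down_up.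
Qed.

Let D_neq0 i j : pt i j \in M -> D i j != 0.
Proof.
move=> /DE DE1; apply/eqP => D0; move: DE1.
by rewrite D0 mul0r => /esym/eqP; rewrite oner_eq0.
Qed.

(** Off [M] both sides are 0, so no membership condition is needed when this is applied to
    covers. *)
Let up_weightE i j : up_weight M y (pt i j) = (D i j)^-1.
Proof.
case: (boolP (pt i j \in M)) => ijM; last by rewrite D_out // /up_weight (negPf ijM) invr0.
have D0 := D_neq0 ijM.
by apply: (mulfI D0); rewrite DE // mulfV.
Qed.

Let D_gt0 i j : pt i j \in M -> 0 < D i j.
Proof.
move=> ijM; rewrite lt_def D_neq0 //=.
rewrite /D /down_weight ijM; apply: sumr_ge0 => C /max_chainsP[CM _ _].
apply: prodr_ge0 => p pC; apply/ltW/xbar_gt0.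
by have := subsetP CM p pC; rewrite inE => /andP[].
Qed.

Let D_rec0 i j : pt i j \in M ->
  D i j = xbar (pt i j) *
    (if (pt i.-1 j \in M) || (pt i j.-1 \in M) then D i.-1 j + D i j.-1 else 1).
Proof.
move=> ijM; apply: down_weight_pt => // a b; move: ijM; rewrite !pt_M; lia.
Qed.

Let D_min : D k 1 = 1.
Proof.
rewrite D_rec0 ?pt_M; last by lia.
rewrite ffunE eqxx mul1r ifF //; lia.
Qed.

Let D_rec i j : pt i j \in M -> (k.+1 < i + j)%N ->
  D i j = x (pt i j) * (D i.-1 j + D i j.-1).
Proof.
move=> ijM kij; rewrite D_rec0 // xbar_pt // ifT //.
by move: ijM; rewrite !pt_M; lia.
Qed.

Let y_rec i j : pt i j \in M -> (i + j < r + k + k.+1)%N ->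
  y (pt i j) * D i j * ((D i.+1 j)^-1 + (D i j.+1)^-1) = 1.
Proof.
move=> ijM ij.
have -> : (D i.+1 j)^-1 + (D i j.+1)^-1
    = up_weight M y (pt i.+1 j) + up_weight M y (pt i j.+1).
  by congr (_ + _); apply/esym/up_weightE.
have E : up_weight M y (pt i j) =
    y (pt i j) * (up_weight M y (pt i.+1 j) + up_weight M y (pt i j.+1)).
  rewrite [LHS]up_weight_pt //; last first.
    by move=> a b; move: ijM; rewrite !pt_M; lia.
  by rewrite ifT //; move: ijM; rewrite !pt_M; lia.
by rewrite mulrAC -E mulrC DE.
Qed.

Let U_top i j : (k.+1 < j)%N -> U0 i j = U i j.
Proof. exact: path_weight_kill_border. Qed.

Let V_top i j : (k.+1 < j <= s.+1)%N -> V i j = U i.+1 j.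
Proof. by move=> kj; apply: path_weight_shift => //; apply: z_top. Qed.

Let V0_top i j : (k.+1 < j <= s.+1)%N -> V0 i j = U i.+1 j.
Proof. by move=> kj; rewrite -V_top //; apply: path_weight_kill_border => //; lia. Qed.

Let U_rec i j : pt i j \in M -> (k.+1 < i + j)%N ->
  U i j = x (pt i j) * (U i.+1 j + U i j.+1).
Proof.
move=> ijM kij; apply: path_weight_rec => //; move: ijM; rewrite pt_M mem_interm //; lia.
Qed.

Let U0_rec i j : pt i j \in M -> (k.+1 < i + j)%N ->
  U0 i j = if (r + j == i.+1)%N then 0 else x (pt i j) * (U0 i.+1 j + U0 i j.+1).
Proof.
move=> ijM kij; rewrite /U0 path_weight_rec //; last first.
  by move: ijM; rewrite pt_M mem_interm //; lia.
move: ijM; rewrite pt_M => ijM; rewrite kill_border_pt; [|lia|lia].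
have -> : (j <= k.+1)%N by lia.
by rewrite /=; case: ifP => // _; rewrite mul0r.
Qed.

Let V_rec i j : pt i j \in M -> (i + j < r + k + k.+1)%N ->
  V i j = y (pt i j) * (V i.+1 j + V i j.+1).
Proof.
move=> ijM ij; rewrite /V path_weight_rec ?z_M //; move: ijM; rewrite pt_M mem_interm //; lia.
Qed.

Let V0_rec i j : pt i j \in M -> (i + j < r + k + k.+1)%N ->
  V0 i j = if (r + j == i.+1)%N then 0 else y (pt i j) * (V0 i.+1 j + V0 i j.+1).
Proof.
move=> ijM ij; rewrite /V0 path_weight_rec //; last first.
  by move: ijM; rewrite pt_M mem_interm //; lia.
have := ijM; rewrite pt_M => ijM'; rewrite kill_border_pt ?z_M //; [|lia|lia].
case: eqP => [e|_]; last by rewrite andbF.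
have -> : (j <= k)%N by lia.
by rewrite mul0r.
Qed.

Let U_out i j : (j <= k.+1)%N -> (r + j <= i)%N -> U i j = 0.
Proof. by move=> jk ij; rewrite /U path_weight_out ?mem_interm //; lia. Qed.

Let V_out z' i j : (j <= k.+1)%N -> (r + minn j k <= i)%N -> path_weight k z' i j = 0.
Proof. by move=> jk ij; rewrite path_weight_out ?mem_interm //; lia. Qed.

Let V_corner : V k 1 = U k.+1 1 + (U k 2 - U0 k 2).
Proof.
apply: (@path_sum_corner _ r k _ _ D (fun i j => x (pt i j))
    (fun i j => y (pt i j)) _ _ _ V0);
  try (by move=> i j; rewrite -pt_M; auto); auto; try lia.
- exact: V_out.
- exact: V_out.
- by move=> i; apply: V_top; lia.
- by move=> i; apply: V0_top; lia.
Qed.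

Let V_column j : (1 < j <= k)%N -> V k j - V0 k j = U k j.+1 - U0 k j.+1.
Proof.
apply: (@path_sum_column _ r k _ _ D (fun i j => x (pt i j)) (fun i j => y (pt i j)));
  try (by move=> i' j'; rewrite -pt_M; auto); auto; try lia.
- exact: V_out.
- exact: V_out.
- by move=> i; apply: V_top; lia.
- by move=> i; apply: V0_top; lia.
Qed.

(** Left of column [k] there is no border point and [z] is [x] shifted by one in [j], so both
    differences obey the same recursion. It starts from column [k], given by [V_column], and from
    the rows above [k], where both differences are 0. *)
Let V_left i j : (0 < i <= k)%N -> (1 < j)%N -> V i j - V0 i j = U i j.+1 - U0 i j.+1.
Proof.
move En : (k + k.+1 - (i + j))%N => n.
elim/ltn_ind: n i j En => n IH i j En ik j1.
case: (ltnP k j) => kj.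
  by rewrite /V0 path_weight_kill_border // U_top ?subrr //; lia.
case: (eqVneq i k) => [->|nik]; first by apply: V_column; lia.
case: (boolP (pt i j \in interm r s k)) => ijI; last first.
  have ijI2 : pt i j.+1 \notin interm r s k.+1.
    by move: ijI; rewrite !mem_interm //; lia.
  by rewrite /V /V0 /U /U0 !path_weight_out ?subrr //; lia.
have := ijI; rewrite mem_interm // => ijI'.
have ijI2 : pt i j.+1 \in interm r s k.+1 by rewrite mem_interm //; lia.
rewrite /V /V0 (@path_weight_rec k _ i j) // (@path_weight_rec k _ i j) //.
rewrite /U /U0 (@path_weight_rec k.+1 _ i j.+1) // (@path_weight_rec k.+1 _ i j.+1) //.
rewrite !kill_border_pt; try lia.
rewrite z_left //; last by lia.
have -> : (r + j == i.+1)%N = false by lia.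
have -> : (r + j.+1 == i.+1)%N = false by lia.
rewrite !andbF.
have e1 : V i.+1 j - V0 i.+1 j = U i.+1 j.+1 - U0 i.+1 j.+1 by apply: IH (erefl _) _ _; lia.
have e2 : V i j.+1 - V0 i j.+1 = U i j.+2 - U0 i j.+2 by apply: IH (erefl _) _ _; lia.
rewrite -!mulrBr !opprD addrACA [in RHS]addrACA.
by congr (_ * (_ + _)); [exact: e1 | exact: e2].
Qed.

(** The corner formula absorbs the start [(k+1, 1)] and the term [i = k] of the sum for [I_{k+1}];
    the other terms match one by one through [V_left]. *)
Lemma touching_weight_step : touching_weight k.+1 x = touching_weight k z.
Proof.
rewrite /touching_weight -/V -/V0 -/U -/U0 V_corner -addrA; congr (_ + _).
rewrite big_nat_recr /=; last by lia.
have -> : (k.+2 - k = 2)%N by lia.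
rewrite [LHS]addrC; congr (_ + _).
apply: eq_big_nat => i ik; rewrite [RHS]V_left; [|lia|lia].
by have -> : (k.+2 - i = (k.+1 - i).+1)%N by lia.
Qed.

End ZetaStep.

(** * The two ends: trapezoid and rectangle *)

Lemma weight_interm k z : (0 < k <= s)%N ->
  weight (max_chains (interm r s k)) z =
  \sum_(1 <= i < k.+1) path_weight k z i (k.+1 - i)%N.
Proof.
move=> ks; pose A := [set p in interm r s k | p.1 + p.2 == k.+1]%N.
have AI p : p \in A -> (p \in interm r s k) && (p.1 + p.2 == k.+1)%N by rewrite in_set.
rewrite (@weight_sum_minimal _ _ _ _ A) //.
- rewrite big_geq_mkord /=.
  rewrite (reindex_onto (fun i : 'I_k.+1 => pt i (k.+1 - i)%N)
                        (fun p => inord p.1)) /=; last first.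
    move=> [a b] /AI/andP[/(off_axes_interm ks) /= ab_gt0 /eqP/= abk].
    rewrite inordK; last by lia.
    have -> : (k.+1 - a = b)%N by lia.
    exact: (ptE (a, b)).
  have inA (i : 'I_k.+1) : (pt i (k.+1 - i)%N \in A) = (0 < i)%N.
    have ik := ltn_ord i.
    rewrite in_set mem_interm // pt1 pt2; (do ?case: ifP); lia.
  apply: eq_big => [i|i].
    have ik := ltn_ord i.
    rewrite inA; case: ltnP => //= i0.
    have -> : nat_of_ord (pt i (k.+1 - i)%N).1 = i by rewrite pt1; case: ifP; lia.
    by rewrite inord_val eqxx.
  move=> /andP[]; rewrite inA => i0 _; have ik := ltn_ord i.
  rewrite /path_weight /up_weight; have -> : (k.+1 - i == s.+1)%N = false by lia.
  by have := inA i; rewrite i0 => /AI/andP[-> _].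
- apply/set0Pn; exists (pt k 1); rewrite mem_interm //; lia.
- by apply/subsetP => p /AI/andP[].
- move=> p q /AI/andP[_ /eqP pk] /AI/andP[_ /eqP qk]; rewrite grid_leE => pq.
  by apply/eqP; rewrite grid_eqE; lia.
- move=> p; rewrite -(ptE p) => pI; have := pI; rewrite mem_interm // => pI'.
  (* The antidiagonal is met below [p] in the column of [p] when [p.1 <= k], and at [(k, 1)]
     otherwise. *)
  pose i := minn p.1 k.
  have iI : pt i (k.+1 - i)%N \in interm r s k by rewrite mem_interm // /i; lia.
  exists (pt i (k.+1 - i)%N).
    rewrite in_set iI pt1 pt2 /i; (do ?case: ifP); lia.
  rewrite grid_leE !pt1 !pt2 /i; (do ?case: ifP); lia.
Qed.

(** Every maximal chain of the trapezoid ends at [(r + s - 1, s)], which is a border point, so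
    killing the border kills every path. *)
Lemma path_weight_kill_border_top z i j : (j <= s)%N ->
  path_weight s (kill_border s z) i j = 0.
Proof.
move=> js; have ss : (0 < s <= s)%N by lia.
move En : (r + s + s - (i + j))%N => n.
elim/ltn_ind: n i j En js => n IH i j En js.
case: (boolP (pt i j \in interm r s s)) => ijI; last by rewrite path_weight_out.
have := ijI; rewrite mem_interm // => ijI'.
rewrite path_weight_rec // kill_border_pt //; [|lia].
case: eqP => e; first by rewrite js mul0r.
rewrite [path_weight _ _ i.+1 j](IH _ _ _ _ (erefl _)) ?add0r; [|lia|lia].
case: (eqVneq j s) => [jE|njs].
  rewrite jE /path_weight eqxx.
  have -> : (i.+1 == r + s)%N = false by lia.
  by rewrite mulr0.
by rewrite (IH _ _ _ _ (erefl _)) ?mulr0 //; lia.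
Qed.

Lemma touching_weight_trapezoid z :
  touching_weight s z = weight (max_chains (trapezoid r s s)) z.
Proof.
rewrite -interm_s weight_interm ?leqnn ?s_gt0 // big_nat_recr //= /touching_weight.
have -> : (s.+1 - s = 1)%N by lia.
rewrite addrC; congr (_ + _); apply: eq_big_nat => i ik.
by rewrite path_weight_kill_border_top ?subr0 //; lia.
Qed.

Lemma touching_weight_rectangle z :
  touching_weight 1 z = weight (max_chains (rectangle r s)) z.
Proof.
by rewrite -interm_1 // weight_interm ?s_gt0 // big_nat1 /touching_weight big_geq ?addr0.
Qed.

(** Positivity is carried through the induction because each step needs it to invert rowmotion. *)
Lemma touching_weight_zeta (x : {ffun grid r s -> R}) m :
  (0 < m <= s)%N -> pos_labelings (trapezoid r s s) x ->
  let y := (\big[(fun f g => f \o g)/id]_(m <= k < s) @zeta_step R r s k) x in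
  pos_labelings (interm r s m) y /\ touching_weight m y = touching_weight s x.
Proof.
move=> ms x_gt0 /=; move En : (s - m)%N => n.
elim: n m En ms => [|n IH] m En ms.
  have -> : m = s by lia.
  by rewrite big_geq //= interm_s.
rewrite big_ltn /=; last by lia.
have [||y_gt0 <-] := IH m.+1; try lia.
have ms' : (0 < m < s)%N by lia.
split; first exact: zeta_step_gt0.
by rewrite touching_weight_step.
Qed.

End Grid.

Theorem theorem4p7 (R : realType) (r s : nat) (hs : (0 < s)%N) (hsr : (s <= r)%N)
    (x : {ffun grid r s -> R})
    (hx : forall p : grid r s, p \in trapezoid r s s -> 0 < x p) :
  weight (max_chains (trapezoid r s s)) x
  = weight (max_chains (rectangle r s)) (zeta x).
Proof.
have [|_ E] := @touching_weight_zeta R r s hs hsr x 1 _ hx; first by rewrite hs.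
by rewrite -touching_weight_trapezoid // -touching_weight_rectangle // -E.
Qed.
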